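(* Consider the closed-loop system $x(k+1)=A_Gx(k)+B_G\pi(x(k))$, where $A_G\in\mathbb{R}^{n_x\times n_x}$, $B_G\in\mathbb{R}^{n_x\times n_u}$ are (unknown) constant matrices and $\pi$ is the neural network controller described in the context. Let $\mathcal{B}$ be a non-empty polytope $$\mathcal{B}=\{x\in\mathbb{R}^{n_x}: e_i^\top(x-x^{inv})+1\ge0,\ i=1,\dots,q\},$$ with $e_i\in\mathbb{R}^{n_x}$ and $x^{inv}\in\mathcal{B}$. Let $U_0\in\mathbb{R}^{n_u\times K}$, $X_0,X_1\in\mathbb{R}^{n_x\times K}$ be the data matrices described in the context (so $X_1=A_GX_0+B_GU_0$), and assume $\mathrm{rank}\begin{bmatrix}U_0\\ X_0\end{bmatrix}=n_x+n_u$ and $\mathrm{rank}(X_1)=n_x$. Let $\alpha_\phi,\beta_\phi,v_*\in\mathbb{R}^{n_\phi}$ be given with $\alpha_\phi\le\beta_\phi$ (elementwise), and $w_*:=\phi(v_* )$. Assume that $\phi$ satisfies elementwise the offset sector $[\alpha_\phi,\beta_\phi]$ centered on the point $(v_*,w_* )$. Assume that the following program is feasible and has an optimal solution, denoted $\{\gamma_i,g_i(w),\Lambda_i\}_{i=1}^q$ (together with $G_1,G_2,G_3$): minimize $\sum_{i=1}^q\gamma_i$ over $\gamma_i\in\mathbb{R}$, $g_i\in\Sigma[w]$, $\lambda_i\in\mathbb{R}^{n_\phi}$ with $\lambda_i\ge0$, $\Lambda_i=\mathrm{diag}(\lambda_i)$ ($i=1,\dots,q$), $G_1\in\mathbb{R}^{K\times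 n_x}$, $G_2\in\mathbb{R}^{K\times n_l}$, $G_3\in\mathbb{R}^{K\times1}$, subject to, for $i=1,\dots,q$, $$e_i^\top[X_1G_1w^0+X_1G_2w^l+X_1G_3-x^{inv}]+\gamma_i-g_i(w)\,[e_i^\top(w^0-x^{inv})+1]-\begin{bmatrix}v_\phi-v_*\\ w_\phi-w_*\end{bmatrix}^\top\begin{bmatrix}-2A_\phi B_\phi\Lambda_i&(A_\phi+B_\phi)\Lambda_i\\ (A_\phi+B_\phi)\Lambda_i&-2\Lambda_i\end{bmatrix}\begin{bmatrix}v_\phi-v_*\\ w_\phi-w_*\end{bmatrix}\in\Sigma[w],$$ and $$\begin{bmatrix}0\\ I_{n_x}\end{bmatrix}=\begin{bmatrix}U_0\\ X_0\end{bmatrix}G_1,\quad\begin{bmatrix}W^{l+1}\\ 0\end{bmatrix}=\begin{bmatrix}U_0\\ X_0\end{bmatrix}G_2,\quad\begin{bmatrix}b^{l+1}\\ 0\end{bmatrix}=\begin{bmatrix}U_0\\ X_0\end{bmatrix}G_3 .$$ If $\gamma_i\le1$ for all $i=1,\dots,q$, then $\mathcal{B}$ is invariant for the closed-loop system, i.e. $A_Gx+B_G\pi(x)\in\mathcal{B}$ for every $x\in\mathcal{B}$.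
   Context: Neural network controller. $\pi:\mathbb{R}^{n_x}\to\mathbb{R}^{n_u}$ is a feed-forward fully connected network with $l$ hidden layers: for input $x$, $w^0=x$, $v^i=W^iw^{i-1}+b^i$ and $w^i=\phi^i(v^i)$ for $i=1,\dots,l$, and $\pi(x)=W^{l+1}w^l+b^{l+1}$. Here $W^i\in\mathbb{R}^{n_i\times n_{i-1}}$, $b^i\in\mathbb{R}^{n_i}$, $n_0=n_x$, $n_{l+1}=n_u$, and $\phi^i(v^i)=[\varphi(v^i_1),\dots,\varphi(v^i_{n_i})]^\top$ for a scalar activation function $\varphi:\mathbb{R}\to\mathbb{R}$. It is assumed throughout that $\pi(0)=0$. Put $n_\phi=n_1+\dots+n_l$, and let $\phi:\mathbb{R}^{n_\phi}\to\mathbb{R}^{n_\phi}$ apply $\varphi$ to each entry. Data. For the open-loop system $x(k+1)=A_Gx(k)+B_Gu(k)$, noise-free data are collected: $U_0=[u(0)\ u(1)\ \cdots\ u(K-1)]$, $X_0=[x(0)\ x(1)\ \cdots\ x(K-1)]$, $X_1=[x(1)\ x(2)\ \cdots\ x(K)]$. Offset sector. For $\alpha\le\beta$ and $\nu_*\in\mathbb{R}$, $\varphi$ satisfies the offset sector $[\alpha,\beta]$ around $(\nu_*,\varphi(\nu_* ))$ if $\big((\varphi(\nu_* )-\varphi(\nu))-\alpha(\nu_*-\nu)\big)\big(\beta(\nu_*-\nu)-(\varphi(\nu_* )-\varphi(\nu))\big)\ge 0$ for all $\nu\in\mathbb{R}$. $\phi$ satisfies elementwise the offset sector $[\alpha_\phi,\beta_\phi]$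 around $(v_*,w_* )$ if for each $i=1,\dots,n_\phi$, the $i$-th component function satisfies the offset sector $[\alpha_\phi^i,\beta_\phi^i]$ around $(v_*^i,\varphi(v_*^i))$. Polynomial notation. In the program, $w=(w^0,w^1,\dots,w^l)$ is a vector of polynomial indeterminates with $w^i$ of dimension $n_i$; $w_\phi=(w^1,\dots,w^l)$, and $v_\phi=(W^1w^0+b^1,\dots,W^lw^{l-1}+b^l)$ is viewed as an affine function of $w$. $\Sigma[w]$ is the set of sum-of-squares polynomials in $w$ with real coefficients. $A_\phi=\mathrm{diag}(\alpha_\phi)$, $B_\phi=\mathrm{diag}(\beta_\phi)$. *)

(* Defs.v *)
From mathcomp Require Import all_boot all_order all_algebra.
From mathcomp Require Import reals.
From mathcomp Require Import mpoly.

Set Implicit Arguments.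
Unset Strict Implicit.
Unset Printing Implicit Defensive.

Import Order.TTheory GRing.Theory Num.Theory.
Local Open Scope ring_scope.

(* The network has width n i at layer i; W i and b i are the weight and bias
   written W^{i+1} and b^{i+1} (one-based), mapping layer i to layer i.+1.
   With l hidden layers only n 0, ..., n l.+1 and W i, b i for i <= l are
   used: the rest of these nat-indexed families is irrelevant. *)

Fixpoint nn_layer (R : realType) (n : nat -> nat) (act : R -> R)
    (W : forall i, 'M[R]_(n i.+1, n i)) (b : forall i, 'cV[R]_(n i.+1))
    (x : 'cV[R]_(n 0%N)) (i : nat) : 'cV[R]_(n i) :=
  if i is j.+1 then map_mx act (W j *m nn_layer act W b x j + b j) else x.

Definition nn_controller (R : realType) (l : nat) (n : nat -> nat)
    (act : R -> R) (W : forall i, 'M[R]_(n i.+1, n i))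
    (b : forall i, 'cV[R]_(n i.+1)) (x : 'cV[R]_(n 0%N)) : 'cV[R]_(n l.+1) :=
  W l *m nn_layer act W b x l + b l.

Definition nphi (l : nat) (n : nat -> nat) : nat := (\sum_(i < l) n i.+1)%N.

Definition offset_sector (R : realType) (act : R -> R) (a b nus : R) : Prop :=
  forall nu : R,
    0 <= ((act nus - act nu) - a * (nus - nu)) *
         (b * (nus - nu) - (act nus - act nu)).

Definition offset_sector_elementwise (R : realType) (m : nat) (act : R -> R)
    (alpha beta vs : 'cV[R]_m) : Prop :=
  forall j : 'I_m, offset_sector act (alpha j 0) (beta j 0) (vs j 0).

Definition data_matrix (R : realType) (m K : nat) (z : nat -> 'cV[R]_m) :
    'M[R]_(m, K) :=
  \matrix_(i < m, k < K) z k i 0.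

Definition polytope (R : realType) (d q : nat) (e : 'I_q -> 'cV[R]_d)
    (xinv x : 'cV[R]_d) : Prop :=
  forall i : 'I_q, 0 <= ((e i)^T *m (x - xinv)) 0 0 + 1.

Definition invariant_set (T : Type) (f : T -> T) (B : T -> Prop) : Prop :=
  forall x, B x -> B (f x).

Definition is_sos (R : realType) (m : nat) (p : {mpoly R[m]}) : Prop :=
  exists s : seq {mpoly R[m]}, p = \sum_(h <- s) h ^+ 2.

Section Program.

Context (R : realType) (l : nat) (n : nat -> nat).

Definition nw : nat := (\sum_(i < l.+1) n i)%N.

Local Notation Rw := {mpoly R[nw]}.

Definition cstmx (p r : nat) (A : 'M[R]_(p, r)) : 'M[Rw]_(p, r) :=
  map_mx (@mpolyC nw R) A.

(* The stacked vector w = (w^0, ..., w^l) of indeterminates. *)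
Definition wpoly : 'cV[Rw]_nw := \col_(j < nw) 'X_j.

Definition wblock (i : 'I_l.+1) : 'cV[Rw]_(n i) :=
  @submxcol Rw l.+1 (fun k => n k) 1 wpoly i.

Definition wphi : 'cV[Rw]_(nphi l n) :=
  @mxcol Rw l (fun i => n i.+1) 1 (fun i => wblock (lift ord0 i)).

Definition vphi (W : forall i, 'M[R]_(n i.+1, n i))
    (b : forall i, 'cV[R]_(n i.+1)) : 'cV[Rw]_(nphi l n) :=
  @mxcol Rw l (fun i => n i.+1) 1
    (fun i => cstmx (W i) *m wblock (widen_ord (leqnSn l) i) + cstmx (b i)).

Definition sector_mx (m : nat) (alpha beta lam : 'cV[R]_m) :
    'M[R]_(m + m) :=
  let A := diag_mx alpha^T in
  let B := diag_mx beta^T in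
  let L := diag_mx lam^T in
  block_mx (- 2 *: (A *m B *m L)) ((A + B) *m L)
           ((A + B) *m L)         (- 2 *: L).

Definition sector_poly (W : forall i, 'M[R]_(n i.+1, n i))
    (b : forall i, 'cV[R]_(n i.+1))
    (alpha beta vs ws lam : 'cV[R]_(nphi l n)) : Rw :=
  let xi := col_mx (vphi W b - cstmx vs) (wphi - cstmx ws) in
  (xi^T *m cstmx (sector_mx alpha beta lam) *m xi) 0 0.

Context (q K : nat).

Record program_point := ProgramPoint {
  gam : 'I_q -> R;
  gpoly : 'I_q -> Rw;
  lambda : 'I_q -> 'cV[R]_(nphi l n);
  G1 : 'M[R]_(K, n 0%N);
  G2 : 'M[R]_(K, n l);
  G3 : 'M[R]_(K, 1)
}.

Definition program_poly (W : forall i, 'M[R]_(n i.+1, n i))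
    (b : forall i, 'cV[R]_(n i.+1)) (e : 'I_q -> 'cV[R]_(n 0%N))
    (xinv : 'cV[R]_(n 0%N)) (X1 : 'M[R]_(n 0%N, K))
    (alpha beta vs ws : 'cV[R]_(nphi l n)) (s : program_point) (i : 'I_q) :
    Rw :=
  let w0 : 'cV[Rw]_(n 0%N) := wblock ord0 in
  let wl : 'cV[Rw]_(n l) := wblock ord_max in
  let eT := cstmx (e i)^T in
  (eT *m (cstmx (X1 *m G1 s) *m w0 + cstmx (X1 *m G2 s) *m wl
          + cstmx (X1 *m G3 s) - cstmx xinv)) 0 0
  + (gam s i)%:MP
  - gpoly s i * ((eT *m (w0 - cstmx xinv)) 0 0 + 1)
  - sector_poly W b alpha beta vs ws (lambda s i).

Definition program_feasible (W : forall i, 'M[R]_(n i.+1, n i))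
    (b : forall i, 'cV[R]_(n i.+1)) (e : 'I_q -> 'cV[R]_(n 0%N))
    (xinv : 'cV[R]_(n 0%N)) (U0 : 'M[R]_(n l.+1, K)) (X0 X1 : 'M[R]_(n 0%N, K))
    (alpha beta vs ws : 'cV[R]_(nphi l n)) (s : program_point) : Prop :=
  [/\ forall i, is_sos (gpoly s i) /\ (forall j, 0 <= lambda s i j 0),
      forall i, is_sos (program_poly W b e xinv X1 alpha beta vs ws s i),
      col_mx 0 1%:M = col_mx U0 X0 *m G1 s,
      col_mx (W l) 0 = col_mx U0 X0 *m G2 s
    & col_mx (b l) 0 = col_mx U0 X0 *m G3 s].

Definition program_optimal (W : forall i, 'M[R]_(n i.+1, n i))
    (b : forall i, 'cV[R]_(n i.+1)) (e : 'I_q -> 'cV[R]_(n 0%N))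
    (xinv : 'cV[R]_(n 0%N)) (U0 : 'M[R]_(n l.+1, K)) (X0 X1 : 'M[R]_(n 0%N, K))
    (alpha beta vs ws : 'cV[R]_(nphi l n)) (s : program_point) : Prop :=
  program_feasible W b e xinv U0 X0 X1 alpha beta vs ws s /\
  forall t, program_feasible W b e xinv U0 X0 X1 alpha beta vs ws t ->
    \sum_(i < q) gam s i <= \sum_(i < q) gam t i.

End Program.

(* Main.v *)
From HB Require Import structures.
Require Import Defs.
From mathcomp Require Import all_boot all_order all_algebra.
From mathcomp Require Import reals.
From mathcomp Require Import mpoly.
From mathcomp Require Import ring.
Local Open Scope ring_scope.

Import Order.TTheory GRing.Theory Num.Theory.

(** The certificate polynomials are evaluated at the outputs of the layers:
    given a state [y], substitute for the indeterminate block [w^i] the actual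
    output of layer [i] on the input [y].  At that point [v_phi] becomes the
    vector of pre-activations and [w_phi] becomes [phi(v_phi)], so the sector
    term is a nonnegative combination of the pointwise offset-sector products
    ([sector_quadratic_form], [sector_poly_eval_ge0]).  Sums of squares take
    nonnegative values ([is_sos_eval_ge0]), so if [y] lies in the polytope then
    both subtracted terms of the program constraint are nonnegative, whence
<<
      e_i^T (X1 (G1 y + G2 w^l + G3) - xinv) + gamma_i >= 0.
>>
    The equality constraints on [G1, G2, G3] say that the combination of data
    columns with coefficients [G1 y + G2 w^l + G3] has state [y] and input
    [pi(y)]; since [X1 = AG X0 + BG U0], the product of [X1] with that
    coefficient vector is the successor state ([closed_loop_from_data]).
    Finally [gamma_i <= 1] gives membership of the successor state in the
    polytope. *)

Lemma is_sos_eval_ge0 (R : realType) (m : nat) (p : {mpoly R[m]})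
    (v : 'I_m -> R) : is_sos p -> 0 <= p.@[v].
Proof.
case=> s ->; rewrite rmorph_sum /=; apply: sumr_ge0 => h _.
by rewrite rmorphXn /= sqr_ge0.
Qed.

Lemma diag_bilinear_form (R : comPzRingType) (m : nat) (d : 'rV[R]_m)
    (y z : 'cV[R]_m) :
  (y^T *m diag_mx d *m z) 0 0 = \sum_j d 0 j * y j 0 * z j 0.
Proof.
rewrite mul_mx_diag mxE; apply: eq_bigr => j _.
by rewrite !mxE [y j 0 * _]mulrC.
Qed.

Lemma sector_quadratic_form (R : realType) (m : nat)
    (alpha beta lam y z : 'cV[R]_m) :
  ((col_mx y z)^T *m sector_mx alpha beta lam *m col_mx y z) 0 0 =
  \sum_j 2 * lam j 0 * ((z j 0 - alpha j 0 * y j 0) *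
                        (beta j 0 * y j 0 - z j 0)).
Proof.
rewrite /sector_mx -linearD /= !mulmx_diag -!linearZ /=.
rewrite tr_col_mx mul_row_block mul_row_col !mulmxDl.
rewrite [LHS]mxE [X in X + _]mxE [X in _ + X]mxE.
rewrite !diag_bilinear_form -!big_split; apply: eq_bigr => j _.
by rewrite !mxE /=; ring.
Qed.

Lemma submxcol_map (S T : Type) (f : S -> T) (p r : nat) (p_ : 'I_p -> nat)
    (A : 'M[S]_(\sum_i p_ i, r)) (i : 'I_p) :
  submxcol (map_mx f A) i = map_mx f (submxcol A i).
Proof. by apply/matrixP => j k; rewrite !mxE. Qed.

Section Evaluation.

Context (R : realType) (l : nat) (n : nat -> nat) (act : R -> R).
Context (W : forall i, 'M[R]_(n i.+1, n i)) (b : forall i, 'cV[R]_(n i.+1)).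
Context (y : 'cV[R]_(n 0%N)).

Local Notation layer := (nn_layer act W b y).

(** The stacked outputs [(w^0, ..., w^l)] of the layers on the input [y]. *)
Definition layer_stack : 'cV[R]_(nw l n) :=
  \mxcol_(i < l.+1) (layer i : 'M[R]_(n i, 1)).

(** The stacked pre-activations [(v^1, ..., v^l)] on the input [y]. *)
Definition preact_stack : 'cV[R]_(nphi l n) :=
  \mxcol_(i < l) (W i *m layer i + b i : 'M[R]_(n i.+1, 1)).

(** Evaluation of polynomials in [w] at [layer_stack]. *)
Definition layer_eval : {mpoly R[nw l n]} -> R :=
  meval (fun j => layer_stack j 0).

HB.instance Definition _ := GRing.RMorphism.on layer_eval.

Lemma layer_eval_cstmx (p r : nat) (A : 'M[R]_(p, r)) :
  map_mx layer_eval (cstmx l n A) = A.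
Proof. by apply/matrixP => i j; rewrite !mxE /layer_eval mevalC. Qed.

Lemma layer_eval_entry (M : 'M[{mpoly R[nw l n]}]_1) :
  layer_eval (M 0 0) = map_mx layer_eval M 0 0.
Proof. by rewrite [RHS]mxE. Qed.

Lemma layer_eval_wblock (i : 'I_l.+1) :
  map_mx layer_eval (wblock R n i) = layer i.
Proof.
rewrite -(mxcolK (fun k : 'I_l.+1 => (layer k : 'M[R]_(n k, 1))) i).
by apply/matrixP => j k; rewrite !mxE /layer_eval mevalXU mxE (ord1 k).
Qed.

Lemma layer_eval_vphi : map_mx layer_eval (vphi l W b) = preact_stack.
Proof.
apply/mxcolP => i; rewrite submxcol_map !mxcolK.
rewrite map_mxD map_mxM !layer_eval_cstmx; congr (_ *m _ + _).
exact: (layer_eval_wblock (widen_ord (leqnSn l) i)).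
Qed.

Lemma layer_eval_wphi :
  map_mx layer_eval (wphi R l n) = map_mx act preact_stack.
Proof.
apply/mxcolP => i; rewrite !submxcol_map !mxcolK.
exact: (layer_eval_wblock (lift ord0 i)).
Qed.

Lemma sector_poly_eval_ge0 (alpha beta vs lam : 'cV[R]_(nphi l n)) :
  offset_sector_elementwise act alpha beta vs ->
  (forall j, 0 <= lam j 0) ->
  0 <= layer_eval (sector_poly W b alpha beta vs (map_mx act vs) lam).
Proof.
move=> hsec hlam; rewrite /sector_poly.
set xi := col_mx _ _.
rewrite layer_eval_entry !map_mxM -map_trmx map_col_mx !map_mxB.
rewrite !layer_eval_cstmx.
rewrite layer_eval_vphi layer_eval_wphi sector_quadratic_form.
apply: sumr_ge0 => j _; apply: mulr_ge0; first by rewrite mulr_ge0.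
(* Both factors are those of the offset sector with their signs reversed. *)
have := hsec j (preact_stack j 0); rewrite !mxE -mulrNN.
by congr (0 <= _ * _); ring.
Qed.

(** The value of the constraint polynomial at the layer outputs;
    [X1 G1 y + X1 G2 w^l + X1 G3] is the successor state predicted from data. *)
Lemma layer_eval_program_poly (q K : nat) (e : 'I_q -> 'cV[R]_(n 0%N))
    (xinv : 'cV[R]_(n 0%N)) (X1 : 'M[R]_(n 0%N, K))
    (alpha beta vs ws : 'cV[R]_(nphi l n)) (s : program_point R l n q K)
    (i : 'I_q) :
  layer_eval (program_poly W b e xinv X1 alpha beta vs ws s i) =
  ((e i)^T *m (X1 *m G1 s *m y + X1 *m G2 s *m layer l
               + X1 *m G3 s - xinv)) 0 0 + gam s i
  - layer_eval (gpoly s i) * (((e i)^T *m (y - xinv)) 0 0 + 1)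
  - layer_eval (sector_poly W b alpha beta vs ws (lambda s i)).
Proof.
rewrite /program_poly !rmorphB /= !rmorphM /= !rmorphD /= rmorph1.
rewrite !layer_eval_entry !map_mxM !map_mxB !map_mxD !map_mxM !layer_eval_cstmx.
(* The dimensions [n ord0] and [n ord_max] of these blocks are only convertible
   to [n 0] and [n l], so [layer_eval_wblock] is not a rewriting rule here. *)
have -> : map_mx layer_eval (wblock R n ord0 : 'cV_(n 0%N)) = y.
  exact: (layer_eval_wblock ord0).
have -> : map_mx layer_eval (wblock R n ord_max : 'cV_(n l)) = layer l.
  exact: (layer_eval_wblock ord_max).
by rewrite [layer_eval _%:MP]mevalC.
Qed.

End Evaluation.

Lemma data_matrix_successor (R : realType) (p r K : nat) (A : 'M[R]_(p, p))
    (B : 'M[R]_(p, r)) (x : nat -> 'cV[R]_p) (u : nat -> 'cV[R]_r) :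
  (forall k, (k < K)%N -> x k.+1 = A *m x k + B *m u k) ->
  data_matrix K (fun k => x k.+1) = A *m data_matrix K x + B *m data_matrix K u.
Proof.
move=> h; apply/matrixP => i k; rewrite !mxE h // !mxE.
by congr (_ + _); apply: eq_bigr => j _; rewrite !mxE.
Qed.

Lemma closed_loop_from_data (R : realType) (p r h K : nat) (A : 'M[R]_(p, p))
    (B : 'M[R]_(p, r)) (U0 : 'M[R]_(r, K)) (X0 : 'M[R]_(p, K))
    (V : 'M[R]_(r, h)) (c : 'cV[R]_r) (G1 : 'M[R]_(K, p)) (G2 : 'M[R]_(K, h))
    (G3 : 'cV[R]_K) (y : 'cV[R]_p) (z : 'cV[R]_h) :
  col_mx 0 1%:M = col_mx U0 X0 *m G1 ->
  col_mx V 0 = col_mx U0 X0 *m G2 ->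
  col_mx c 0 = col_mx U0 X0 *m G3 ->
  let X1 := A *m X0 + B *m U0 in
  X1 *m G1 *m y + X1 *m G2 *m z + X1 *m G3 = A *m y + B *m (V *m z + c).
Proof.
rewrite !mul_col_mx => /eq_col_mx[eU1 eX1] /eq_col_mx[eU2 eX2].
move=> /eq_col_mx[eU3 eX3] /=.
rewrite !mulmxDl -!mulmxA -eU3 -eX3 !(mulmxA U0) !(mulmxA X0).
rewrite -eU1 -eX1 -eU2 -eX2 !mul0mx !mulmx0 mul1mx !addr0 !add0r.
by rewrite mulmxDr !addrA.
Qed.

Theorem theorem6 (R : realType) (l : nat) (n : nat -> nat) (act : R -> R)
  (W : forall i : nat, 'M[R]_(n i.+1, n i))
  (b : forall i : nat, 'cV[R]_(n i.+1))
  (hpi0 : nn_controller l act W b 0 = 0)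
  (AG : 'M[R]_(n 0%N, n 0%N)) (BG : 'M[R]_(n 0%N, n l.+1))
  (q : nat) (e : 'I_q -> 'cV[R]_(n 0%N)) (xinv : 'cV[R]_(n 0%N))
  (hne : exists x : 'cV[R]_(n 0%N), polytope e xinv x)
  (hxinv : polytope e xinv xinv)
  (K : nat) (x : nat -> 'cV[R]_(n 0%N)) (u : nat -> 'cV[R]_(n l.+1))
  (htraj : forall k : nat, (k < K)%N -> x k.+1 = AG *m x k + BG *m u k)
  (U0 : 'M[R]_(n l.+1, K)) (X0 X1 : 'M[R]_(n 0%N, K))
  (hU0 : U0 = data_matrix K u)
  (hX0 : X0 = data_matrix K x)
  (hX1 : X1 = data_matrix K (fun k : nat => x k.+1))
  (hrank : \rank (col_mx U0 X0) = (n 0 + n l.+1)%N)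
  (hrank1 : \rank X1 = n 0%N)
  (alpha beta vs ws : 'cV[R]_(nphi l n))
  (hab : forall j : 'I_(nphi l n), alpha j 0 <= beta j 0)
  (hws : ws = map_mx act vs)
  (hsec : offset_sector_elementwise act alpha beta vs)
  (s : program_point R l n q K)
  (hopt : program_optimal W b e xinv U0 X0 X1 alpha beta vs ws s)
  (hgam : forall i : 'I_q, gam s i <= 1) :
  invariant_set (fun x : 'cV[R]_(n 0%N) => AG *m x + BG *m nn_controller l act W b x)
    (polytope e xinv).
Proof.
case: hopt => -[hpos hsos hG1 hG2 hG3] _ y hy i.
have [hg hlam] := hpos i.
have := is_sos_eval_ge0 _ _ _ (fun j => layer_stack R l n act W b y j 0)
  (hsos i).
rewrite -/(layer_eval R l n act W b y _) layer_eval_program_poly.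
rewrite hX1 (data_matrix_successor _ _ _ _ _ _ _ _ htraj) -hX0 -hU0.
rewrite (closed_loop_from_data _ _ _ _ _ _ _ _ _ _ _ _ _ _ _ _ hG1 hG2 hG3).
rewrite -/(nn_controller l act W b y) hws.
have hsector := sector_poly_eval_ge0 R l n act W b y _ _ _ _ hsec hlam.
have hprod := mulr_ge0
  (is_sos_eval_ge0 _ _ _ (fun j => layer_stack R l n act W b y j 0) hg) (hy i).
rewrite !subr_ge0 => /(le_trans hsector); rewrite subr_ge0.
move=> /(le_trans hprod) h; apply: (le_trans h).
by rewrite lerD2l.
Qed.
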